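(* Let $G$ be a finite connected simple graph. Then $$c_0(G) \leq \begin{cases} \alpha'(G), & \text{if } G \text{ has a perfect matching};\\ \alpha'(G) + 1, & \text{otherwise}.\end{cases}$$ Moreover, if $G$ has $n$ vertices, then $c_0(G) \leq \left\lceil \frac{n}{2} \right\rceil$.
   Context: The 0-visibility cops and robber game on a finite connected simple graph $G$ is played by a team of cops (controlled by one player) and one robber, all occupying vertices of $G$. First the cops choose their starting vertices (several cops may share a vertex), then the robber chooses his starting vertex. Then the players alternate turns, cops first: on the cops' turn each cop stays or moves to an adjacent vertex; on the robber's turn he stays or moves to an adjacent vertex. The cops do not see the robber's position unless some cop is on the same vertex as him. The robber sees the cops and is omniscient: he knows the complete strategy of the cops in advance, so he is never captured by chance, i.e. a winning cop strategy must guarantee capture against every possible play of the robber. The cops win if after finitely many rounds some cop occupies the same vertex as the robber; otherwise the robber wins. The 0-visibility cop number $c_0(G)$ is the minimum number of cops that have a winning strategy on $G$. The matching number $\alpha'(G)$ is the maximum size of a matching in $G$. *)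

(* Defs.v *)
From mathcomp Require Import all_boot.
From mathcomp Require Import boolp.

Set Implicit Arguments.
Unset Strict Implicit.
Unset Printing Implicit Defensive.

(* A finite simple graph is a symmetric irreflexive relation e on a finType;  *)
(* these two hypotheses are stated where they are used.                       *)

Definition connected_graph (T : finType) (e : rel T) : Prop :=
  forall x y, connect e x y.

Definition edge_set (T : finType) (e : rel T) : {set {set T}} :=
  [set [set p.1; p.2] | p : T * T & e p.1 p.2].

Definition matching (T : finType) (e : rel T) (M : {set {set T}}) : bool :=
  (M \subset edge_set e) && trivIset M.

Definition perfect_matching (T : finType) (e : rel T) (M : {set {set T}}) :
    bool :=
  matching e M && (cover M == [set: T]).

Definition has_perfect_matching (T : finType) (e : rel T) : bool :=
  [exists M, perfect_matching e M].

Definition matching_number (T : finType) (e : rel T) : nat :=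
  \max_(M | matching e M) #|M|.

Definition legal_walk (T : finType) (e : rel T) (w : nat -> T) : Prop :=
  forall t, w t.+1 = w t \/ e (w t) (w t.+1).

(* The cops observe nothing about the robber before the capture, at which the *)
(* game is over; hence a strategy for k cops is a sequence of positions fixed *)
(* in advance: c 0 is the initial placement and c t is the placement after    *)
(* the t-th cops' turn.                                                       *)
Definition cop_strategy (T : finType) (e : rel T) (k : nat)
    (c : nat -> 'I_k -> T) : Prop :=
  forall i, legal_walk e (fun t => c t i).

(* r 0 is the robber's initial vertex and r t his vertex after his t-th turn. *)
(* The order of play is c 0, r 0, c 1, r 1, ..., so r t meets the cops at c t *)
(* (when the robber arrives) and at c t.+1 (when the cops move next).         *)
Definition captured (T : finType) (k : nat) (c : nat -> 'I_k -> T)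
    (r : nat -> T) : Prop :=
  exists t, exists i, c t i = r t \/ c t.+1 i = r t.

Definition winning_strategy (T : finType) (e : rel T) (k : nat)
    (c : nat -> 'I_k -> T) : Prop :=
  cop_strategy e c /\ forall r, legal_walk e r -> captured c r.

Definition cops_win (T : finType) (e : rel T) (k : nat) : Prop :=
  exists c : nat -> 'I_k -> T, winning_strategy e c.

(* One cop on each vertex wins, so the minimum in cop_number0 exists.         *)
Lemma cops_win_ex (T : finType) (e : rel T) : exists k, `[< cops_win e k >].
Proof.
exists #|T|; apply/asboolP; exists (fun _ i => enum_val i); split=> [i t|r _].
  by left.
by exists 0, (enum_rank (r 0)); left; rewrite enum_rankK.
Qed.

Definition cop_number0 (T : finType) (e : rel T) : nat :=
  ex_minn (cops_win_ex e).

(* Main.v *)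
Require Import Defs.
From mathcomp Require Import all_boot.
From mathcomp Require Import boolp.

(** Fix a matching [M] and let one cop per edge of [M] shuttle between the two
    ends of that edge for ever.  A robber who ever stands on a vertex covered
    by [M] is lost: the cop of that edge either is there already or arrives
    with the very next move.  So the robber must stay among the uncovered
    vertices.

    If [M] is perfect there are none, and the shuttling cops suffice
    ([shuttles_win]).  If [M] is maximum, the uncovered vertices are
    independent ([uncovered_independent]), for an edge between two of them
    could be added to [M].  The robber is then frozen where he started, and one
    extra cop, who tours the connected graph, runs into him
    ([shuttles_and_tour_win]).

    The bound by half the order follows: the edges of [M] cover exactly
    [2 * #|M|] vertices, and at least one vertex is left over when the extra cop
    is used. *)

Set Implicit Arguments.
Unset Strict Implicit.
Unset Printing Implicit Defensive.

Section ZeroVisibility.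

Variables (T : finType) (e : rel T).

Lemma cop_number0_min k : cops_win e k -> cop_number0 e <= k.
Proof.
by move=> win; rewrite /cop_number0; case: ex_minnP => m _; apply; apply/asboolP.
Qed.

(** Allowing an arbitrary finite type of cops lets each cop be named after the
    matching edge that it patrols. *)
Lemma cops_win_card (I : finType) (c : nat -> I -> T) :
    (forall i, legal_walk e (c^~ i)) ->
    (forall r, legal_walk e r ->
       exists t i, c t i = r t \/ c t.+1 i = r t) ->
  cops_win e #|I|.
Proof.
move=> legal_c capture; exists (fun t j => c t (enum_val j)).
split=> [j|r /capture[t [i cap]]]; first exact: legal_c.
by exists t, (enum_rank i); rewrite enum_rankK.
Qed.

Definition shuttle (p : T * T) (t : nat) : T := if odd t then p.2 else p.1.

Lemma shuttle_legal p : symmetric e -> e p.1 p.2 -> legal_walk e (shuttle p).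
Proof.
move=> e_sym ep t; right; rewrite /shuttle /=.
by case: (odd t); rewrite //= e_sym.
Qed.

(** Two consecutive positions of a shuttle are the two ends of its edge. *)
Lemma shuttle_hits p t x :
  x \in [set p.1; p.2] -> shuttle p t = x \/ shuttle p t.+1 = x.
Proof.
by rewrite /shuttle /= => /set2P[] ->; case: (odd t); [right|left|left|right].
Qed.

Lemma edge_endpoints (M : {set {set T}}) : matching e M ->
  exists p : {A | A \in M} -> T * T,
    forall i, val i = [set (p i).1; (p i).2] /\ e (p i).1 (p i).2.
Proof.
case/andP=> /subsetP M_edges _.
apply: (fin_all_exists
  (P := fun i q => val i = [set q.1; q.2] /\ e q.1 q.2)) => -[A AM] /=.
by have /imsetP[p] := M_edges A AM; rewrite inE => ep ->; exists p.
Qed.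

Lemma shuttles_win (M : {set {set T}}) :
  symmetric e -> perfect_matching e M -> cops_win e #|M|.
Proof.
move=> e_sym /andP[/edge_endpoints[p pP] /eqP coverM].
rewrite -card_sig; apply: (cops_win_card (c := fun t i => shuttle (p i) t)).
  by move=> i; apply: shuttle_legal => //; case: (pP i).
move=> r _; have /bigcupP[A AM rA]: r 0 \in cover M by rewrite coverM inE.
exists 0, (exist _ A AM); apply: shuttle_hits.
by case: (pP (exist _ A AM)) => <-.
Qed.

(** By appending, for each vertex to be visited, a path that leads to it from
    the end of the walk so far. *)
Lemma covering_path x (s : seq T) : connected_graph e ->
  exists2 q, path e x q & {subset s <= x :: q}.
Proof.
move=> e_conn; elim: s => [|y s [q q_path sq]]; first by exists [::].
have /connectP[q' q'_path y_last] := e_conn (last x q) y.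
exists (q ++ q'); first by rewrite cat_path q_path.
move=> z /[!inE] /orP[/eqP-> | /sq z_q]; last first.
  by rewrite -in_cons -cat_cons mem_cat z_q.
by rewrite y_last -last_cat -in_cons mem_last.
Qed.

Lemma tour_exists (x : T) : connected_graph e ->
  exists2 w, legal_walk e w & forall y, exists t, w t = y.
Proof.
move=> e_conn; have [q q_path q_all] := covering_path x (enum T) e_conn.
(* The default value makes the walk rest at the last vertex of the path. *)
exists (nth (last x q) (x :: q)) => [t|y]; last first.
  by exists (index y (x :: q)); rewrite nth_index // q_all ?mem_enum.
have [t_lt|t_ge] := ltnP t (size q).
  by right; move/(pathP (last x q)): q_path; apply.
left; rewrite nth_default //; move: t_ge; rewrite leq_eqVlt => /predU1P[<-|t_gt].
  by rewrite -last_nth.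
by rewrite nth_default.
Qed.

(** Independence of the uncovered vertices pins the robber to one of them: each
    of his moves would otherwise be an edge with both ends uncovered. *)
Lemma shuttles_and_tour_win (M : {set {set T}}) (x : T) :
    symmetric e -> connected_graph e -> matching e M ->
    {in ~: cover M &, forall y z, ~~ e y z} ->
  cops_win e #|M|.+1.
Proof.
move=> e_sym e_conn /edge_endpoints[p pP] indep.
have [w w_legal w_all] := tour_exists x e_conn.
rewrite -(card_sig (mem M)) -card_option.
(* [Some i] patrols the edge [i]; [None] tours the graph. *)
pose c t i := if i is Some j then shuttle (p j) t else w t.
apply: (cops_win_card (c := c)).
  by case=> [i|] //; apply: shuttle_legal => //; case: (pP i).
move=> r r_legal.
have [[t /bigcupP[A AM rA]]|r_out] := pselect (exists t, r t \in cover M).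
  exists t, (Some (exist _ A AM)); apply: shuttle_hits.
  by case: (pP (exist _ A AM)) => <-.
have r_unc t : r t \in ~: cover M.
  by rewrite inE; apply/negP => rt; apply: r_out; exists t.
have r_const t : r t = r 0.
  elim: t => // t <-; case: (r_legal t) => // er.
  by have := indep _ _ (r_unc t) (r_unc t.+1); rewrite er.
by have [t wt] := w_all (r 0); exists t, None; left; rewrite /= wt r_const.
Qed.

Lemma set0_notin_matching (M : {set {set T}}) : matching e M -> set0 \notin M.
Proof.
case/andP=> /subsetP M_edges _; apply/negP => /M_edges/imsetP[p _ /setP/(_ p.1)].
by rewrite !inE eqxx.
Qed.

(** An edge avoiding the cover could be added to [M], against its maximality. *)
Lemma uncovered_independent (M : {set {set T}}) :
    matching e M -> #|M| = matching_number e ->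
  {in ~: cover M &, forall y z, ~~ e y z}.
Proof.
move=> mM M_max y z /[!inE] yM zM; apply/negP => eyz.
have [M_edges M_triv] := andP mM.
have yz_disj A : A \in M -> [disjoint [set y; z] & A].
  move=> AM; rewrite disjoint_subset; apply/subsetP => u u_yz.
  rewrite !inE; apply/negP => uA.
  have: u \in cover M by apply/bigcupP; exists A.
  by case/set2P: u_yz => ->; apply/negP.
have [big_triv yz_notin] := trivIsetU1 yz_disj M_triv (set0_notin_matching mM).
have big_matching: matching e ([set y; z] |: M).
  rewrite /matching big_triv andbT subUset M_edges andbT sub1set.
  by apply/imsetP; exists (y, z); rewrite ?inE.
have := leq_bigmax_cond (F := fun N : {set {set T}} => #|N|) _ big_matching.
by rewrite -/(matching_number e) cardsU1 yz_notin -M_max ltnn.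
Qed.

Lemma card_cover_matching (M : {set {set T}}) :
  irreflexive e -> matching e M -> #|cover M| = #|M|.*2.
Proof.
move=> e_irr /andP[/subsetP M_edges /eqP <-].
rewrite -muln2 -sum_nat_const; apply: eq_bigr => A /M_edges/imsetP[p].
rewrite inE => ep ->; rewrite cards2; case: eqP => // p12.
by move: ep; rewrite p12 e_irr.
Qed.

Lemma maximum_matching_exists :
  exists2 M, matching e M & #|M| = matching_number e.
Proof.
have m0 : matching e set0.
  by rewrite /matching sub0set /trivIset /cover !big_set0 cards0 eqxx.
have [|M mM M_max] := @eq_bigmax_cond _ (matching e) (fun N => #|N|).
  by apply/card_gt0P; exists set0.
by exists M.
Qed.

End ZeroVisibility.

Theorem theorem3p1 (T : finType) (e : rel T)
    (e_sym : symmetric e) (e_irr : irreflexive e)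
    (e_conn : connected_graph e) :
  cop_number0 e <= (if has_perfect_matching e then matching_number e
                    else matching_number e + 1)
  /\ cop_number0 e <= uphalf #|T|.
Proof.
case: ifPn => [/existsP[M pM] | no_perfect].
  have [mM /eqP coverM] := andP pM.
  have c0_le := cop_number0_min (shuttles_win e_sym pM).
  split; apply: (leq_trans c0_le).
    exact: (leq_bigmax_cond (F := fun N : {set {set T}} => #|N|)).
  by rewrite -cardsT -coverM (card_cover_matching e_irr mM) uphalf_double.
have [M mM M_max] := maximum_matching_exists e.
have coverM : cover M \proper [set: T].
  rewrite properEneq subsetT andbT.
  apply: contraNneq no_perfect => cM; apply/existsP; exists M.
  by rewrite /perfect_matching mM cM /=.
have [_ [x _ _]] := properP coverM.
have c0_le: cop_number0 e <= #|M|.+1.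
  apply/cop_number0_min/(shuttles_and_tour_win x) => //.
  exact: uncovered_independent.
split; first by rewrite addn1 -M_max.
apply: (leq_trans c0_le); move: (proper_card coverM).
by rewrite cardsT (card_cover_matching e_irr mM) gtn_uphalf_double.
Qed.
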